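(* For every $\mathsf{xFrege}$ proof of length $l$ and size $n$ there exists an $\mathsf{xSKSg}$ proof of the same formula whose length and size are respectively $O(l)$ and $O(n^2)$.
   Context: CoS: formulae built from units $\mathsf f,\mathsf t$, atoms $a,\bar a,\dots$, formula variables $A,\bar A,\dots$ by $[\alpha\vee\beta]$ and $(\alpha\wedge\beta)$; $\bar\cdot$ involution on atoms and on variables with $\bar a\ne a$, $\bar A\ne A$; the De Morgan dual $\bar\alpha$ exchanges $\vee/\wedge$, $\mathsf t/\mathsf f$ and negates atoms and variables. Equality $=$ is the smallest context-closed equivalence containing commutativity and associativity of $\vee,\wedge$, $[\alpha\vee\mathsf f]=\alpha$, $(\alpha\wedge\mathsf t)=\alpha$, $[\mathsf t\vee\mathsf t]=\mathsf t$, $(\mathsf f\wedge\mathsf f)=\mathsf f$. A rule $\alpha/\beta$ has instances $\alpha\rho\sigma/\beta\rho\sigma$ (renaming $\rho$ of atoms, substitution $\sigma$ of formulae for variables, $\bar A\mapsto$ dual) and generates steps $\xi\{\gamma\}/\xi\{\delta\}$ for any context (formula with one hole) $\xi$. A derivation in $\mathcal S$ from premiss $\alpha_0$ to conclusion $\alpha_k$ is a chain alternating $=$-steps and steps generated by rules of $\mathcal S$; length = number of steps; size = number of occurrences of units, atoms, variables. $\mathsf{SKSg}$ has the rules $\mathsf t/[A\vee\bar A]$, $(A\wedge\bar A)/\mathsf f$, $\mathsf f/A$, $A/\mathsf t$, $[A\vee A]/A$, $A/(A\wedge A)$, $(A\wedge[B\vee C])/[(A\wedge B)\vee C]$. $\mathsf{xSKSg}$: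 an extended $\mathsf{SKSg}$ proof of $\alpha$ is an $\mathsf{SKSg}$ derivation with conclusion $\alpha$ and premiss $([\bar A_1\vee\beta_1]\wedge[\bar\beta_1\vee A_1]\wedge\dots\wedge[\bar A_h\vee\beta_h]\wedge[\bar\beta_h\vee A_h])$, where $A_1,\bar A_1,\dots,A_h,\bar A_h$ are mutually distinct variables and, for each $i$, neither $A_i$ nor $\bar A_i$ occurs in $\beta_1,\dots,\beta_i,\alpha$. $\mathsf{Frege}$: formulae over $\mathsf t,\mathsf f$, non-negated variables, $\vee,\wedge,\to,\neg$; axiom schemes $F_1: A\to(B\to(A\wedge B))$; $F_2:(A\wedge B)\to A$; $F_3:(A\wedge B)\to B$; $F_4:A\to(A\vee B)$; $F_5:B\to(A\vee B)$; $F_6:\neg\neg A\to A$; $F_7:A\to\neg\neg A$; $F_8:A\to(B\to A)$; $F_9:\neg A\to(A\to B)$; $F_{10}:(A\to(B\to C))\to((A\to B)\to(A\to C))$; $F_{11}:(A\to C)\to((B\to C)\to((A\vee B)\to C))$; $F_{12}:(A\to(B\to C))\to(B\to(A\to C))$; $F_{13}:(A\to B)\to(\neg B\to\neg A)$; $F_{14}:\mathsf f\to(A\wedge\neg A)$; $F_{15}:(A\wedge\neg A)\to\mathsf f$; $F_{16}:\mathsf t\to(A\vee\neg A)$; $F_{17}:(A\vee\neg A)\to\mathsf t$ (instances by substituting formulae), and modus ponens. $\mathsf{xFrege}$: a proof is a sequence $\alpha_1,\dots,\alpha_k$ (conclusion $\alpha_k$) in which each formula is an axiom instance, follows by modus ponens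 from earlier formulae, or is an extension instance $A\leftrightarrow\beta$ (shorthand for $((A\to\beta)\wedge(\beta\to A))$) with the variable $A$ not occurring in any earlier formula, in $\beta$, or in $\alpha_k$; length = number of formulae; size = number of occurrences of units and variables. Translation: atoms/variables ↔ Frege variables, negated atoms/variables ↔ $\neg$ of variables, $\neg\alpha$ ↔ dual, $\alpha\to\beta$ ↔ $[\bar\alpha\vee\beta]$. *)

(* Defs.v *)
(* MathComp *)
From HB Require Import structures.
From mathcomp Require Import all_boot.

Set Implicit Arguments.
Unset Strict Implicit.
Unset Printing Implicit Defensive.

(* Atoms and formula variables both form a countable set with a fixpoint-free
   involution: (n, true) is the negation of (n, false).  The constructors Atom
   and Var below keep the two kinds apart. *)
Definition literal := (nat * bool)%type.
Definition neg (x : literal) : literal := (x.1, ~~ x.2).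

(** * Calculus of structures *)

Inductive form :=
  | Ff
  | Tt
  | Atom of literal
  | Var of literal
  | Or of form & form
  | And of form & form.

Definition form_eq_dec (a b : form) : decidable (a = b).
Proof. by rewrite /decidable; decide equality; apply: eq_comparable. Defined.
HB.instance Definition _ := comparableMixin form_eq_dec.

Fixpoint dual (a : form) : form :=
  match a with
  | Ff => Tt
  | Tt => Ff
  | Atom x => Atom (neg x)
  | Var x => Var (neg x)
  | Or b c => And (dual b) (dual c)
  | And b c => Or (dual b) (dual c)
  end.

Fixpoint form_size (a : form) : nat :=
  match a with
  | Or b c | And b c => form_size b + form_size c
  | _ => 1
  end.

Fixpoint form_vars (a : form) : seq literal :=
  match a with
  | Var x => [:: x]
  | Or b c | And b c => form_vars b ++ form_vars c
  | _ => [::]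
  end.

Inductive context :=
  | Hole
  | OrL of context & form
  | OrR of form & context
  | AndL of context & form
  | AndR of form & context.

Fixpoint plug (xi : context) (a : form) : form :=
  match xi with
  | Hole => a
  | OrL xi' b => Or (plug xi' a) b
  | OrR b xi' => Or b (plug xi' a)
  | AndL xi' b => And (plug xi' a) b
  | AndR b xi' => And b (plug xi' a)
  end.

Inductive form_equiv : form -> form -> Prop :=
  | fe_orC a b : form_equiv (Or a b) (Or b a)
  | fe_andC a b : form_equiv (And a b) (And b a)
  | fe_orA a b c : form_equiv (Or (Or a b) c) (Or a (Or b c))
  | fe_andA a b c : form_equiv (And (And a b) c) (And a (And b c))
  | fe_orf a : form_equiv (Or a Ff) a
  | fe_andt a : form_equiv (And a Tt) a
  | fe_ortt : form_equiv (Or Tt Tt) Tt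
  | fe_andff : form_equiv (And Ff Ff) Ff
  | fe_refl a : form_equiv a a
  | fe_sym a b : form_equiv a b -> form_equiv b a
  | fe_trans a b c : form_equiv a b -> form_equiv b c -> form_equiv a c
  | fe_ctx xi a b : form_equiv a b -> form_equiv (plug xi a) (plug xi b).

(* A renaming (resp. substitution) is given by its values on the positive atoms
   (resp. variables) and extended so as to commute with negation. *)
Fixpoint rename (rho : nat -> literal) (a : form) : form :=
  match a with
  | Atom (n, s) => Atom (if s then neg (rho n) else rho n)
  | Or b c => Or (rename rho b) (rename rho c)
  | And b c => And (rename rho b) (rename rho c)
  | _ => a
  end.

Fixpoint subst (sigma : nat -> form) (a : form) : form :=
  match a with
  | Var (n, s) => if s then dual (sigma n) else sigma n
  | Or b c => Or (subst sigma b) (subst sigma c)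
  | And b c => And (subst sigma b) (subst sigma c)
  | _ => a
  end.

(* The rule (a, b) has premiss a and conclusion b. *)
Definition rule := (form * form)%type.
Definition cos_system := seq rule.

Definition rule_step (S : cos_system) (a b : form) : Prop :=
  exists r rho sigma xi,
    [/\ r \in S,
        a = plug xi (subst sigma (rename rho r.1))
      & b = plug xi (subst sigma (rename rho r.2))].

(* Steps along a :: s alternate; eqfirst says whether the first one is an
   equality step. *)
Fixpoint alternating (S : cos_system) (eqfirst : bool) (a : form)
    (s : seq form) : Prop :=
  match s with
  | [::] => True
  | b :: s' => (if eqfirst then form_equiv a b else rule_step S a b)
               /\ alternating S (~~ eqfirst) b s'
  end.

(* A derivation is a :: s, with premiss a and conclusion last a s; its number
   of steps is size s. *)
Definition derivation (S : cos_system) (a : form) (s : seq form) : Prop :=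
  exists eqfirst : bool, alternating S eqfirst a s.

Definition derivation_length (a : form) (s : seq form) : nat := size s.
Definition derivation_size (a : form) (s : seq form) : nat :=
  \sum_(b <- a :: s) form_size b.

Definition SKSg : cos_system :=
  let A := Var (0, false) in
  let B := Var (1, false) in
  let C := Var (2, false) in
  [:: (Tt, Or A (dual A));
      (And A (dual A), Ff);
      (Ff, A);
      (A, Tt);
      (Or A A, A);
      (A, And A A);
      (And A (Or B C), Or (And A B) C)].

(* The empty conjunction is t, so that a proof using no extension is an
   ordinary SKSg proof, i.e. a derivation with premiss t. *)
Fixpoint conj_seq (s : seq form) : form :=
  match s with
  | [::] => Tt
  | [:: a] => a
  | a :: s' => And a (conj_seq s')
  end.

(* E lists the pairs (A_i, beta_i). *)
Definition ext_premiss (E : seq (literal * form)) : form :=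
  conj_seq (flatten [seq [:: Or (Var (neg e.1)) e.2;
                             Or (dual e.2) (Var e.1)] | e <- E]).

Definition xSKSg_proof (E : seq (literal * form)) (s : seq form)
    (alpha : form) : Prop :=
  [/\ uniq (flatten [seq [:: e.1; neg e.1] | e <- E]),
      forall i, i < size E -> forall b,
        b \in alpha :: [seq e.2 | e <- take i.+1 E] ->
        let A := (nth ((0, false), Tt) E i).1 in
        A \notin form_vars b /\ neg A \notin form_vars b,
      derivation SKSg (ext_premiss E) s
    & last (ext_premiss E) s = alpha].

(** * Frege systems *)

Inductive fform :=
  | Fff
  | Ftt
  | Fvar of nat
  | For of fform & fform
  | Fand of fform & fform
  | Fimp of fform & fform
  | Fneg of fform.

Definition fform_eq_dec (a b : fform) : decidable (a = b).
Proof. by rewrite /decidable; decide equality; apply: eq_comparable. Defined.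
HB.instance Definition _ := comparableMixin fform_eq_dec.

Definition Fiff (a b : fform) : fform := Fand (Fimp a b) (Fimp b a).

Fixpoint fform_size (a : fform) : nat :=
  match a with
  | For b c | Fand b c | Fimp b c => fform_size b + fform_size c
  | Fneg b => fform_size b
  | _ => 1
  end.

Fixpoint fform_vars (a : fform) : seq nat :=
  match a with
  | Fvar x => [:: x]
  | For b c | Fand b c | Fimp b c => fform_vars b ++ fform_vars c
  | Fneg b => fform_vars b
  | _ => [::]
  end.

Fixpoint fsubst (sigma : nat -> fform) (a : fform) : fform :=
  match a with
  | Fvar n => sigma n
  | For b c => For (fsubst sigma b) (fsubst sigma c)
  | Fand b c => Fand (fsubst sigma b) (fsubst sigma c)
  | Fimp b c => Fimp (fsubst sigma b) (fsubst sigma c)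
  | Fneg b => Fneg (fsubst sigma b)
  | _ => a
  end.

Declare Scope frege_scope.
Delimit Scope frege_scope with F.
Local Notation "a ⇒ b" := (Fimp a b)
  (at level 55, right associativity) : frege_scope.
Local Notation "a ∨ b" := (For a b)
  (at level 50, left associativity) : frege_scope.
Local Notation "a ∧ b" := (Fand a b)
  (at level 40, left associativity) : frege_scope.
Local Notation "¬ a" := (Fneg a) (at level 35, right associativity)
  : frege_scope.

Definition frege_schemes : seq fform :=
  let A := Fvar 0 in
  let B := Fvar 1 in
  let C := Fvar 2 in
  [:: A ⇒ (B ⇒ (A ∧ B));
      (A ∧ B) ⇒ A;
      (A ∧ B) ⇒ B;
      A ⇒ (A ∨ B);
      B ⇒ (A ∨ B);
      ¬ ¬ A ⇒ A;
      A ⇒ ¬ ¬ A;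
      A ⇒ (B ⇒ A);
      ¬ A ⇒ (A ⇒ B);
      (A ⇒ (B ⇒ C)) ⇒ ((A ⇒ B) ⇒ (A ⇒ C));
      (A ⇒ C) ⇒ ((B ⇒ C) ⇒ ((A ∨ B) ⇒ C));
      (A ⇒ (B ⇒ C)) ⇒ (B ⇒ (A ⇒ C));
      (A ⇒ B) ⇒ (¬ B ⇒ ¬ A);
      Fff ⇒ (A ∧ ¬ A);
      (A ∧ ¬ A) ⇒ Fff;
      Ftt ⇒ (A ∨ ¬ A);
      (A ∨ ¬ A) ⇒ Ftt]%F.

Definition frege_axiom (a : fform) : Prop :=
  exists sigma F, F \in frege_schemes /\ a = fsubst sigma F.

Definition modus_ponens (earlier : seq fform) (a : fform) : Prop :=
  exists b, b \in earlier /\ Fimp b a \in earlier.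

Definition frege_extension (earlier : seq fform) (concl a : fform) : Prop :=
  exists A b,
    [/\ a = Fiff (Fvar A) b,
        forall g, g \in earlier -> A \notin fform_vars g,
        A \notin fform_vars b
      & A \notin fform_vars concl].

Definition xFrege_proof (p : seq fform) (concl : fform) : Prop :=
  [/\ p <> [::],
      last Ftt p = concl
    & forall i, i < size p ->
        let earlier := take i p in
        let a := nth Ftt p i in
        [\/ frege_axiom a,
            modus_ponens earlier a
          | frege_extension earlier concl a]].

Definition frege_length (p : seq fform) : nat := size p.
Definition frege_size (p : seq fform) : nat := \sum_(a <- p) fform_size a.

(** * Translation *)

Fixpoint translate (a : fform) : form :=
  match a with
  | Fff => Ff
  | Ftt => Tt
  | Fvar n => Var (n, false)
  | For b c => Or (translate b) (translate c)
  | Fand b c => And (translate b) (translate c)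
  | Fimp b c => Or (dual (translate b)) (translate c)
  | Fneg b => dual (translate b)
  end.

(* Main.v *)
(** Carry the conjunction S of the extension premiss and of the translations of
    the lines obtained so far.  Up to equality any conjunct of S can be brought
    to the front, so coweakening extracts it from a copy of S in one rule step.
    Modus ponens is then a switch and a cut on two extracted conjuncts, and an
    axiom instance comes from t by substituting into one of 17 fixed
    derivations.  Each Frege line thus costs O(1) steps on formulae of size
    O(n), which gives O(l) steps and total size O(l n) = O(n^2). *)
Require Import Defs.
From mathcomp Require Import all_boot zify.

Set Implicit Arguments.
Unset Strict Implicit.
Unset Printing Implicit Defensive.

(** * Duality, sizes, contexts and substitutions *)

Lemma negK : involutive neg.
Proof. by case=> n b; rewrite /neg /= negbK. Qed.

Lemma dualK : involutive dual.
Proof. by elim=> //= [x|x|a -> b ->|a -> b ->] //; rewrite negK. Qed.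

Lemma form_size_gt0 a : 0 < form_size a.
Proof. by elim: a => //= a IHa b IHb; rewrite addn_gt0 IHa. Qed.

Lemma form_size_dual a : form_size (dual a) = form_size a.
Proof. by elim: a => //= a -> b ->. Qed.

Lemma form_equiv_and a a' b b' :
  form_equiv a a' -> form_equiv b b' -> form_equiv (And a b) (And a' b').
Proof.
move=> ha hb; apply: fe_trans (fe_ctx (AndL Hole b) ha) _.
exact: (fe_ctx (AndR a' Hole) hb).
Qed.

Fixpoint context_size (xi : context) : nat :=
  match xi with
  | Hole => 0
  | OrL xi' b | OrR b xi' | AndL xi' b | AndR b xi' =>
      context_size xi' + form_size b
  end.

Lemma form_size_plug xi a : form_size (plug xi a) = context_size xi + form_size a.
Proof. by elim: xi => //= [xi IH b|b xi IH|xi IH b|b xi IH]; rewrite IH; lia. Qed.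

Fixpoint context_comp (xi zeta : context) : context :=
  match xi with
  | Hole => zeta
  | OrL xi' b => OrL (context_comp xi' zeta) b
  | OrR b xi' => OrR b (context_comp xi' zeta)
  | AndL xi' b => AndL (context_comp xi' zeta) b
  | AndR b xi' => AndR b (context_comp xi' zeta)
  end.

Lemma plug_comp xi zeta a : plug (context_comp xi zeta) a = plug xi (plug zeta a).
Proof. by elim: xi => //= [xi -> b|b xi ->|xi -> b|b xi ->]. Qed.

Lemma rule_step_plug S xi a b :
  rule_step S a b -> rule_step S (plug xi a) (plug xi b).
Proof.
case=> r [rho [sigma [zeta [rS -> ->]]]].
by exists r, rho, sigma, (context_comp xi zeta); rewrite !plug_comp.
Qed.

Lemma subst_dual sigma a : subst sigma (dual a) = dual (subst sigma a).
Proof. by elim: a => //= [[n []]|a -> b ->|a -> b ->] //=; rewrite dualK. Qed.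

Lemma subst_subst tau sigma a :
  subst tau (subst sigma a) = subst (fun n => subst tau (sigma n)) a.
Proof.
by elim: a => //= [[n []]|a -> b ->|a -> b ->] //=; rewrite subst_dual.
Qed.

Fixpoint context_subst (sigma : nat -> form) (xi : context) : context :=
  match xi with
  | Hole => Hole
  | OrL xi' b => OrL (context_subst sigma xi') (subst sigma b)
  | OrR b xi' => OrR (subst sigma b) (context_subst sigma xi')
  | AndL xi' b => AndL (context_subst sigma xi') (subst sigma b)
  | AndR b xi' => AndR (subst sigma b) (context_subst sigma xi')
  end.

Lemma subst_plug sigma xi a :
  subst sigma (plug xi a) = plug (context_subst sigma xi) (subst sigma a).
Proof. by elim: xi => //= [xi -> b|b xi ->|xi -> b|b xi ->]. Qed.

Lemma form_equiv_subst sigma a b :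
  form_equiv a b -> form_equiv (subst sigma a) (subst sigma b).
Proof.
elim=> {a b} /=; try by move=> *; constructor.
- by move=> a b c _ hab _; apply: fe_trans.
- by move=> xi a b _ hab; rewrite !subst_plug; apply: fe_ctx.
Qed.

Lemma rule_step_subst S tau a b :
  rule_step S a b -> rule_step S (subst tau a) (subst tau b).
Proof.
case=> r [rho [sigma [xi [rS -> ->]]]].
exists r, rho, (fun n => subst tau (sigma n)), (context_subst tau xi).
by rewrite !subst_plug !subst_subst.
Qed.

Lemma form_size_subst sigma m a :
  0 < m -> (forall n, form_size (sigma n) <= m) ->
  form_size (subst sigma a) <= form_size a * m.
Proof.
move=> m_gt0 hm.
elim: a => //= [| | |[n b]|a IHa b IHb|a IHa b IHb]; rewrite ?mul1n //.
- by case: b => //; rewrite form_size_dual.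
- by rewrite mulnDl leq_add.
- by rewrite mulnDl leq_add.
Qed.

(** * Derivations with bounds on length and width *)

(* k bounds the number of rule steps and w the sizes of all formulae; putting an
   equality step before every rule step makes concatenations alternate. *)
Inductive derives : nat -> nat -> form -> form -> Prop :=
  | derives_equiv k w a b :
      form_equiv a b -> form_size a <= w -> form_size b <= w -> derives k w a b
  | derives_rule k w a a' b' b :
      form_equiv a a' -> rule_step SKSg a' b' ->
      form_size a <= w -> form_size a' <= w ->
      derives k w b' b -> derives k.+1 w a b.

Lemma derives_leq k w k' w' a b :
  k <= k' -> w <= w' -> derives k w a b -> derives k' w' a b.
Proof.
move=> + lew d; elim: d k' lew => {k w a b}
  [k w a b hab ha hb|k w a a' b' b haa' r ha ha' _ IH] k' lew lek.
  by apply: derives_equiv => //; apply: leq_trans lew.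
case: k' lek => // k' lek; apply: derives_rule haa' r _ _ (IH _ lew lek).
- exact: leq_trans lew.
- exact: leq_trans lew.
Qed.

(** Two adjacent equality steps fuse into one, so the alternation survives and no rule step is
    added. *)
Lemma derives_equiv_trans k w a b c :
  form_equiv a b -> form_size a <= w -> derives k w b c -> derives k w a c.
Proof.
move=> + + d; elim: d a => {k w b c} [k w b c hbc hb hc|k w b b' c' c hbb' r hb hb' d _] a hab ha.
  by apply: derives_equiv => //; apply: fe_trans hbc.
exact: derives_rule (fe_trans hab hbb') r ha hb' d.
Qed.

(** The closing equality step of the first derivation is absorbed by the opening one of the second,
    so rule steps just add up. *)
Lemma derives_trans j k w a b c :
  derives j w a b -> derives k w b c -> derives (j + k) w a c.
Proof.
move=> d; elim: d c => {j w a b} [j w a b hab ha hb|j w a a' b' b haa' r ha ha' _ IH] c dc.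
  by apply: (derives_equiv_trans hab) => //; apply: derives_leq dc; rewrite ?leq_addl.
by rewrite addSn; apply: derives_rule haa' r ha ha' (IH _ dc).
Qed.

Lemma derives_plug xi k w a b :
  derives k w a b -> derives k (context_size xi + w) (plug xi a) (plug xi b).
Proof.
elim=> {k w a b} [k w a b hab ha hb|k w a a' b' b haa' r ha ha' _ IH].
  by apply: derives_equiv; rewrite ?form_size_plug ?leq_add2l //; apply: fe_ctx.
by apply: derives_rule (fe_ctx xi haa') (rule_step_plug xi r) _ _ IH;
   rewrite form_size_plug leq_add2l.
Qed.

(** Equality and rule steps are closed under substitution, and each leaf becomes a formula of size
    at most [m]; units and atoms stay of size 1, hence [0 < m]. *)
Lemma derives_subst sigma m k w a b :
  0 < m -> (forall n, form_size (sigma n) <= m) ->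
  derives k w a b -> derives k (w * m) (subst sigma a) (subst sigma b).
Proof.
move=> m_gt0 hm.
have le c v : form_size c <= v -> form_size (subst sigma c) <= v * m.
  by move=> hc; apply: leq_trans (form_size_subst c m_gt0 hm) _; rewrite leq_mul2r hc orbT.
elim=> {k w a b} [k w a b hab ha hb|k w a a' b' b haa' r ha ha' _ IH].
  by apply: derives_equiv; rewrite ?le //; apply: form_equiv_subst.
by apply: derives_rule (form_equiv_subst sigma haa') (rule_step_subst sigma r) _ _ IH;
   rewrite le.
Qed.

(** Each of the [k] rule steps is preceded by an equality step and one more closes the chain: at
    most 2k+1 steps, hence 2k+2 formulae of size at most [w]. *)
Lemma derives_derivation k w a b :
  derives k w a b ->
  exists s, [/\ derivation SKSg a s, last a s = b, size s <= k.*2.+1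
              & derivation_size a s <= (k.*2 + 2) * w].
Proof.
move=> d; suff [s [hs ls ss ws]] : exists s, [/\ alternating SKSg true a s,
    last a s = b, size s <= k.*2.+1 & all (fun c => form_size c <= w) (a :: s)].
  exists s; split=> //; first by exists true.
  rewrite /derivation_size; apply: (@leq_trans (\sum_(c <- a :: s) w)).
    by rewrite !big_seq; apply: leq_sum => c /(allP ws).
  rewrite big_const_seq count_predT iter_addn_0 mulnC leq_mul2r /=.
  by rewrite addn2 ltnS ss orbT.
elim: d => {k w a b} [k w a b hab ha hb|k w a a' b' b haa' r ha ha' _ [s [hs ls ss ws]]].
  by exists [:: b]; rewrite /= ha hb.
exists [:: a', b' & s]; split=> //; last by rewrite /= ha ha'.
Qed.


(** * Unbounded derivability and derived rules *)

(** Forgetting the bounds is harmless for finitely many fixed derivations: their lengths and sizes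
    are constants, recovered later from the existentials. *)
Definition derivable (a b : form) : Prop := exists k w, derives k w a b.

Lemma derivable_equiv a b : form_equiv a b -> derivable a b.
Proof.
move=> hab; exists 0, (form_size a + form_size b).
by apply: derives_equiv; rewrite ?leq_addr ?leq_addl.
Qed.

Lemma derivable_refl a : derivable a a.
Proof. exact/derivable_equiv/fe_refl. Qed.

Lemma derivable_trans b a c : derivable a b -> derivable b c -> derivable a c.
Proof.
case=> [j [v hab]] [k [w hbc]]; exists (j + k), (v + w).
by apply: derives_trans (derives_leq _ _ hab) (derives_leq _ _ hbc);
   rewrite ?leq_addr ?leq_addl.
Qed.

Lemma derivable_plug xi a b :
  derivable a b -> derivable (plug xi a) (plug xi b).
Proof.
by case=> k [w hab]; exists k, (context_size xi + w); apply: derives_plug.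
Qed.

Lemma derivable_and a a' b b' :
  derivable a a' -> derivable b b' -> derivable (And a b) (And a' b').
Proof.
move=> ha hb; apply: derivable_trans (derivable_plug (AndL Hole b) ha) _.
exact: (derivable_plug (AndR a' Hole) hb).
Qed.

Lemma derivable_or a a' b b' :
  derivable a a' -> derivable b b' -> derivable (Or a b) (Or a' b').
Proof.
move=> ha hb; apply: derivable_trans (derivable_plug (OrL Hole b) ha) _.
exact: (derivable_plug (OrR a' Hole) hb).
Qed.

Lemma derives_rule_step w a b :
  rule_step SKSg a b -> form_size a <= w -> form_size b <= w -> derives 1 w a b.
Proof.
move=> r wa wb; apply: (derives_rule (fe_refl a) r wa wa).
exact: (derives_equiv 0 (fe_refl b) wb wb).
Qed.

Lemma derivable_rule_step a b : rule_step SKSg a b -> derivable a b.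
Proof.
move=> r; exists 1, (form_size a + form_size b).
by apply: derives_rule_step; rewrite ?leq_addr ?leq_addl.
Qed.

Lemma SKSg_instance (r : rule) a b c :
  r \in SKSg ->
  rule_step SKSg (subst (nth Tt [:: a; b; c]) r.1) (subst (nth Tt [:: a; b; c]) r.2).
Proof.
(* [pair^~ false] is the identity renaming. The rules use only variables 0, 1 and 2, which receive
   [a], [b] and [c]. *)
move=> rS; exists r, (pair^~ false), (nth Tt [:: a; b; c]), Hole; split=> //.
all: by move: rS; rewrite !inE; do ![case/predU1P=> [-> //|]] => /eqP->.
Qed.

Lemma identity_step a : rule_step SKSg Tt (Or a (dual a)).
Proof. exact: (@SKSg_instance (nth (Tt, Tt) SKSg 0) a a a). Qed.

Lemma cut_step a : rule_step SKSg (And a (dual a)) Ff.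
Proof. exact: (@SKSg_instance (nth (Tt, Tt) SKSg 1) a a a). Qed.

Lemma weakening_step a : rule_step SKSg Ff a.
Proof. exact: (@SKSg_instance (nth (Tt, Tt) SKSg 2) a a a). Qed.

Lemma coweakening_step a : rule_step SKSg a Tt.
Proof. exact: (@SKSg_instance (nth (Tt, Tt) SKSg 3) a a a). Qed.

Lemma contraction_step a : rule_step SKSg (Or a a) a.
Proof. exact: (@SKSg_instance (nth (Tt, Tt) SKSg 4) a a a). Qed.

Lemma cocontraction_step a : rule_step SKSg a (And a a).
Proof. exact: (@SKSg_instance (nth (Tt, Tt) SKSg 5) a a a). Qed.

Lemma switch_step a b c : rule_step SKSg (And a (Or b c)) (Or (And a b) c).
Proof. exact: (@SKSg_instance (nth (Tt, Tt) SKSg 6) a b c). Qed.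

Lemma derivable_andl a b : derivable (And a b) a.
Proof.
apply: (@derivable_trans (And a Tt)); last exact/derivable_equiv/fe_andt.
apply: derivable_and (derivable_refl a) _.
exact/derivable_rule_step/coweakening_step.
Qed.

Lemma derivable_andr a b : derivable (And a b) b.
Proof.
exact: derivable_trans (derivable_equiv (fe_andC a b)) (derivable_andl b a).
Qed.

Lemma derivable_orl a b : derivable a (Or a b).
Proof.
apply: (@derivable_trans (Or a Ff)).
  exact/derivable_equiv/fe_sym/fe_orf.
apply: derivable_or (derivable_refl a) _.
exact/derivable_rule_step/weakening_step.
Qed.

Lemma derivable_orr a b : derivable b (Or a b).
Proof.
exact: derivable_trans (derivable_orl b a) (derivable_equiv (fe_orC b a)).
Qed.

Lemma derivable_and_intro x a b :
  derivable x a -> derivable x b -> derivable x (And a b).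
Proof.
move=> ha hb; apply: derivable_trans (derivable_and ha hb).
exact/derivable_rule_step/cocontraction_step.
Qed.

Lemma derivable_or_elim a b c :
  derivable a c -> derivable b c -> derivable (Or a b) c.
Proof.
move=> ha hb; apply: derivable_trans (derivable_or ha hb) _.
exact/derivable_rule_step/contraction_step.
Qed.

(** Switch yields [Or (And a (dual a)) b]; cut turns the left disjunct into f, which equality
    removes. *)
Lemma derivable_cut a b : derivable (And a (Or (dual a) b)) b.
Proof.
apply: derivable_trans (derivable_rule_step (switch_step _ _ _)) _.
apply: (@derivable_trans (Or Ff b)).
  apply: derivable_or (derivable_refl b).
  exact/derivable_rule_step/cut_step.
exact/derivable_equiv/(fe_trans (fe_orC _ _))/fe_orf.
Qed.

(** A deduction theorem: adjoin t to [x], expand it to [Or a (dual a)] by identity, and switch [x]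
    next to [a]. *)
Lemma derivable_curry x a b :
  derivable (And x a) b -> derivable x (Or (dual a) b).
Proof.
move=> hb; apply: (@derivable_trans (And x (Or a (dual a)))).
  apply: derivable_trans (derivable_equiv (fe_sym (fe_andt x))) _.
  apply: derivable_and (derivable_refl x) _.
  exact/derivable_rule_step/identity_step.
apply: derivable_trans (derivable_rule_step (switch_step _ _ _)) _.
apply: derivable_trans (derivable_equiv (fe_orC _ _)).
exact: derivable_or hb (derivable_refl _).
Qed.

Lemma derivable_weaken x y a : derivable x a -> derivable (And x y) a.
Proof. exact/derivable_trans/derivable_andl. Qed.

(** With [derivable_mp] this gives natural deduction on translated formulae, where [x] is the
    left-nested conjunction of the open hypotheses. *)
Lemma derivable_imp x a b :
  derivable (And x (translate a)) (translate b) ->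
  derivable x (translate (Fimp a b)).
Proof. exact: derivable_curry. Qed.

Lemma derivable_mp x a b :
  derivable x (translate (Fimp a b)) -> derivable x (translate a) ->
  derivable x (translate b).
Proof.
move=> hab ha; apply: derivable_trans (derivable_cut (translate a) _).
exact: derivable_and_intro.
Qed.

(** The context [x] is moved to the right as [dual x], which leaves a plain case analysis on
    [Or a b]; a cut against [x] then recovers [c]. *)
Lemma derivable_and_or_elim x a b c :
  derivable (And x a) c -> derivable (And x b) c -> derivable (And x (Or a b)) c.
Proof.
have swap d : derivable (And x d) c -> derivable d (Or (dual x) c).
  move=> hd; apply: derivable_curry.
  exact: derivable_trans (derivable_equiv (fe_andC _ _)) hd.
move=> /swap ha /swap hb; apply: derivable_trans (derivable_cut x c).
exact: derivable_and (derivable_refl x) (derivable_or_elim ha hb).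
Qed.

Lemma derivable_frege_scheme F : F \in frege_schemes -> derivable Tt (translate F).
Proof.
rewrite !inE; repeat case/predU1P=> [->|]; last move/eqP->.
- do 2 apply: derivable_imp; apply: derivable_and_intro; last exact: derivable_andr.
  exact/derivable_weaken/derivable_andr.
- apply: derivable_imp; exact/(derivable_trans (derivable_andr _ _))/derivable_andl.
- apply: derivable_imp; exact/(derivable_trans (derivable_andr _ _))/derivable_andr.
- apply: derivable_imp; exact/(derivable_trans (derivable_andr _ _))/derivable_orl.
- apply: derivable_imp; exact/(derivable_trans (derivable_andr _ _))/derivable_orr.
(* In this scheme and the next one the double negation disappears, since [dual] applied twice to a
   variable computes back to it. *)
- apply: derivable_imp; exact: derivable_andr.
- apply: derivable_imp; exact: derivable_andr.
- do 2 apply: derivable_imp; exact/derivable_weaken/derivable_andr.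
- do 2 apply: derivable_imp.
  apply: (@derivable_trans (And (translate (Fvar 0)) (dual (translate (Fvar 0))))).
    apply: derivable_and_intro; first exact: derivable_andr.
    exact/derivable_weaken/derivable_andr.
  apply: derivable_trans (derivable_rule_step (cut_step _)) _.
  exact/derivable_rule_step/weakening_step.
- do 3 apply: derivable_imp; apply: (@derivable_mp _ (Fvar 1)).
    apply: (@derivable_mp _ (Fvar 0)); last exact: derivable_andr.
    exact/derivable_weaken/derivable_weaken/derivable_andr.
  apply: (@derivable_mp _ (Fvar 0)); last exact: derivable_andr.
  exact/derivable_weaken/derivable_andr.
- do 3 apply: derivable_imp; apply: derivable_and_or_elim.
    apply: (@derivable_mp _ (Fvar 0)); last exact: derivable_andr.
    exact/derivable_weaken/derivable_weaken/derivable_andr.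
  apply: (@derivable_mp _ (Fvar 1)); last exact: derivable_andr.
  exact/derivable_weaken/derivable_andr.
- do 3 apply: derivable_imp; apply: (@derivable_mp _ (Fvar 1)).
    apply: (@derivable_mp _ (Fvar 0)); last exact: derivable_andr.
    exact/derivable_weaken/derivable_weaken/derivable_andr.
  exact/derivable_weaken/derivable_andr.
(* Contraposition: both implications translate to the same disjunction up to the order of the
   disjuncts. *)
- apply: derivable_imp; apply: derivable_trans (derivable_andr _ _) _.
  exact/derivable_equiv/fe_orC.
- apply: derivable_imp; apply: derivable_trans (derivable_andr _ _) _.
  exact/derivable_rule_step/weakening_step.
- apply: derivable_imp; apply: derivable_trans (derivable_andr _ _) _.
  exact/derivable_rule_step/cut_step.
- apply: derivable_imp; apply: derivable_trans (derivable_andl _ _) _.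
  exact/derivable_rule_step/identity_step.
- apply: derivable_imp; exact/derivable_rule_step/coweakening_step.
Qed.

(** * Uniform bounds for axiom instances and modus ponens *)

Lemma derives_uniform (s : seq (form * form)) :
  (forall x, x \in s -> derivable x.1 x.2) ->
  exists k w, forall x, x \in s -> derives k w x.1 x.2.
Proof.
elim: s => [|x s IH] hs; first by exists 0, 0.
have [y ys|k [w hkw]] := IH; first by apply: hs; rewrite inE ys orbT.
have [j [v hjv]] := hs x (mem_head x s).
exists (j + k), (v + w) => y; rewrite inE => /predU1P[->|ys].
  by apply: derives_leq hjv; rewrite leq_addr.
by apply: derives_leq (hkw y ys); rewrite leq_addl.
Qed.

(** Makes every translated axiom instance a substitution instance of one of finitely many translated
    schemes. *)
Lemma translate_fsubst sigma F :
  translate (fsubst sigma F) = subst (translate \o sigma) (translate F).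
Proof.
by elim: F => //= [a -> b ->|a -> b ->|a -> b ->|a ->] //=; rewrite subst_dual.
Qed.

Lemma form_size_translate a : form_size (translate a) = fform_size a.
Proof.
by elim: a => //= [a -> b ->|a -> b ->|a IHa b ->|a]; rewrite ?form_size_dual ?IHa.
Qed.

Lemma form_vars_dual a : form_vars (dual a) = map neg (form_vars a).
Proof. by elim: a => //= a -> b ->; rewrite map_cat. Qed.

Lemma form_vars_translate a x : x \in form_vars (translate a) -> x.1 \in fform_vars a.
Proof.
elim: a x => //= [n x|a IHa b IHb x|a IHa b IHb x|a IHa b IHb x|a IHa x].
- by rewrite inE => /eqP->; rewrite mem_head.
- by rewrite !mem_cat => /orP[/IHa->|/IHb->]; rewrite ?orbT.
- by rewrite !mem_cat => /orP[/IHa->|/IHb->]; rewrite ?orbT.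
- rewrite form_vars_dual !mem_cat => /orP[/mapP[y /IHa ya ->]|/IHb->].
    by rewrite ya.
  by rewrite orbT.
- by rewrite form_vars_dual => /mapP[y /IHa ya ->].
Qed.

Lemma eq_in_fsubst sigma tau F :
  {in fform_vars F, sigma =1 tau} -> fsubst sigma F = fsubst tau F.
Proof.
elim: F => //= [n h|a IHa b IHb h|a IHa b IHb h|a IHa b IHb h|a IHa h].
- by apply: h; rewrite mem_head.
all: by rewrite ?IHa ?IHb // => n hn; apply: h; rewrite ?mem_cat hn ?orbT.
Qed.

Lemma fform_size_fsubst_var sigma F n :
  n \in fform_vars F -> fform_size (sigma n) <= fform_size (fsubst sigma F).
Proof.
elim: F => //= [m|a IHa b IHb|a IHa b IHb|a IHa b IHb].
- by rewrite inE => /eqP->.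
all: rewrite mem_cat => /orP[/IHa|/IHb] h; apply: leq_trans h _;
     by rewrite ?leq_addr ?leq_addl.
Qed.

Lemma fform_size_gt0 a : 0 < fform_size a.
Proof. by rewrite -form_size_translate form_size_gt0. Qed.

(** The constants bound the fixed derivations of all schemes; substituting into one of them
    multiplies its width by at most the size of the instance. *)
Lemma derives_frege_axiom :
  exists k w, forall a, frege_axiom a ->
    derives k (w * fform_size a) Tt (translate a).
Proof.
have [|k [w hkw]] := @derives_uniform [seq (Tt, translate F) | F <- frege_schemes].
  by move=> x /mapP[F FS ->]; apply: derivable_frege_scheme.
exists k, w => _ [sigma [F [FS ->]]].
(* Off the variables of [F] the values of [sigma] may be arbitrarily large. Resetting them to t
   bounds all values by the size of the instance. *)
pose tau n := if n \in fform_vars F then sigma n else Ftt.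
have -> : fsubst sigma F = fsubst tau F.
  by apply: eq_in_fsubst => n nF; rewrite /tau nF.
rewrite translate_fsubst.
have := hkw _ (map_f (fun F => (Tt, translate F)) FS).
apply: derives_subst => [|n]; first exact: fform_size_gt0.
rewrite /= form_size_translate.
case: (boolP (n \in fform_vars F)) => [|nF]; first exact: fform_size_fsubst_var.
by rewrite /tau (negPf nF) fform_size_gt0.
Qed.

Lemma derives_cut :
  exists k w, forall a b,
    derives k (w * (form_size a + form_size b)) (And a (Or (dual a) b)) b.
Proof.
have [k [w hkw]] := derivable_cut (Var (0, false)) (Var (1, false)).
exists k, w => a b.
apply: (derives_subst (sigma := nth Tt [:: a; b]) _ _ hkw) => [|n].
  by rewrite addn_gt0 form_size_gt0.
(* Variables other than the first two receive the default t, of size 1. *)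
case: n => [|[|n]] /=; rewrite ?leq_addr ?leq_addl // nth_nil.
by rewrite addn_gt0 form_size_gt0.
Qed.

Lemma derives_form_size k w a b :
  derives k w a b -> form_size a <= w /\ form_size b <= w.
Proof. by elim=> {k w a b} // k w a a' b' b _ _ ? _ _ []. Qed.

(** One cocontraction duplicates [x], then each copy is rewritten while the other conjunct, of size
    at most [w], stays idle. *)
Lemma derives_and_intro j k w x a b :
  derives j w x a -> derives k w x b -> derives (j + k).+1 (w + w) x (And a b).
Proof.
move=> ha hb.
have [xw aw] := derives_form_size ha; have [_ bw] := derives_form_size hb.
rewrite -add1n; apply: (@derives_trans _ _ _ _ (And x x)).
  by apply: derives_rule_step (cocontraction_step x) _ _ => /=; lia.
apply: (@derives_trans _ _ _ _ (And a x)).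
  by apply: derives_leq (derives_plug (AndL Hole x) ha) => //=; lia.
by apply: derives_leq (derives_plug (AndR a Hole) hb) => //=; lia.
Qed.

(** * Extracting conjuncts from a conjunction *)

(* The extra 1 in the size bound lets r be t when a is b itself. *)
Definition conjunct (b a : form) : Prop :=
  exists r, form_equiv a (And b r) /\ form_size b + form_size r <= (form_size a).+1.

Lemma conjunct_refl a : conjunct a a.
Proof. by exists Tt; split; [apply/fe_sym/fe_andt | rewrite addn1]. Qed.

Lemma conjunct_andl a b c : conjunct b a -> conjunct b (And a c).
Proof.
case=> r [har le_r]; exists (And r c); split; last by move=> /=; lia.
apply: fe_trans (form_equiv_and har (fe_refl c)) _; exact: fe_andA.
Qed.

Lemma conjunct_andr a b c : conjunct b a -> conjunct b (And c a).
Proof.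
case/(@conjunct_andl _ _ c)=> r [har le_r].
exists r; split; last by move: le_r => /=; lia.
exact: fe_trans (fe_andC c a) har.
Qed.

(** Equality brings [b] to the front, a single coweakening sends the remainder [r] to t, and
    equality absorbs t. *)
Lemma conjunct_derives a b : conjunct b a -> derives 1 (form_size a).+1 a b.
Proof.
case=> r [har le_r]; have r_gt0 := form_size_gt0 r.
apply: derives_equiv_trans har _ _ => //.
have step := rule_step_plug (AndR b Hole) (coweakening_step r).
apply: derives_rule (fe_refl _) step _ _ _ => //.
by apply: derives_equiv (fe_andt b) _ _ => /=; lia.
Qed.

(** * The extension premiss *)

Definition extension_axiom (e : nat * fform) : fform := Fiff (Fvar e.1) e.2.

Definition translate_extension (e : nat * fform) : literal * form :=
  ((e.1, false), translate e.2).

Lemma conjunct_ext_premiss E e :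
  e \in E ->
  conjunct (translate (extension_axiom e))
    (ext_premiss [seq translate_extension x | x <- E]).
Proof.
elim: E => // e1 [|e2 E] IH.
  by rewrite inE => /eqP->; apply: conjunct_refl.
(* The premiss lists the two implications of an equivalence as separate conjuncts, nested to the
   right; reassociation groups them into the translated extension axiom. *)
have assoc b c x y : conjunct b (And (And x y) c) -> conjunct b (And x (And y c)).
  case=> r [hr le_r]; exists r; split; last by move: le_r => /=; rewrite addnA.
  exact: fe_trans (fe_sym (fe_andA x y c)) hr.
rewrite inE => eE; apply: assoc; case/predU1P: eE => [->|/IH].
  exact/conjunct_andl/conjunct_refl.
exact: conjunct_andr.
Qed.

(** The successor accounts for the empty conjunction, which is t. *)
Lemma form_size_conj_seq s : form_size (conj_seq s) <= (\sum_(a <- s) form_size a).+1.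
Proof.
elim: s => [|a [|b s] IH]; first by rewrite big_nil.
  by rewrite big_seq1.
by rewrite big_cons /= -addnS leq_add2l.
Qed.

Lemma form_size_ext_premiss E :
  form_size (ext_premiss [seq translate_extension x | x <- E])
    <= (frege_size [seq extension_axiom x | x <- E]).+1.
Proof.
apply: leq_trans (form_size_conj_seq _) _; rewrite ltnS /frege_size.
elim: E => [|e E IH]; first by rewrite !big_nil.
rewrite /= !big_cons addnA leq_add //=.
by rewrite form_size_dual form_size_translate; lia.
Qed.

Lemma uniq_literals (s : seq nat) :
  uniq s -> uniq (flatten [seq [:: (n, false); neg (n, false)] | n <- s]).
Proof.
have fst_mem x (r : seq nat) :
    x \in flatten [seq [:: (n, false); neg (n, false)] | n <- r] -> x.1 \in r.
  by case/flatten_mapP=> n nr; rewrite !inE => /orP[] /eqP->.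
elim: s => //= n s IH /andP[ns /IH ->].
by rewrite inE andbT xpair_eqE /= andbF;
   apply/andP; split; apply: contra ns => /fst_mem.
Qed.

(** * Collecting the extensions of a Frege proof *)

(** Scan the proof and append a pair to [E] at each line accepted only as an extension. Each pair is
    charged to its own line, which bounds the total size. *)
Lemma frege_extensions p concl :
  xFrege_proof p concl ->
  exists E : seq (nat * fform),
    [/\ uniq [seq e.1 | e <- E],
        forall j, j < size E -> forall b,
          b \in concl :: [seq e.2 | e <- take j.+1 E] ->
          (nth (0, Ftt) E j).1 \notin fform_vars b,
        frege_size [seq extension_axiom e | e <- E] <= frege_size p
      & forall i, i < size p ->
          [\/ frege_axiom (nth Ftt p i), modus_ponens (take i p) (nth Ftt p i)
            | exists2 e, e \in E & nth Ftt p i = extension_axiom e]].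
Proof.
case=> _ _ hp.
(* The induction on prefixes also records that every collected axiom is a line of the prefix, so
   that freshness for earlier lines gives freshness for earlier extensions. *)
suff: forall n, n <= size p -> exists E : seq (nat * fform),
    [/\ uniq [seq e.1 | e <- E],
        forall j, j < size E -> forall b,
          b \in concl :: [seq e.2 | e <- take j.+1 E] ->
          (nth (0, Ftt) E j).1 \notin fform_vars b,
        frege_size [seq extension_axiom e | e <- E] <= frege_size (take n p),
        {subset [seq extension_axiom e | e <- E] <= take n p}
      & forall i, i < n ->
          [\/ frege_axiom (nth Ftt p i), modus_ponens (take i p) (nth Ftt p i)
            | exists2 e, e \in E & nth Ftt p i = extension_axiom e]].
  by case/(_ _ (leqnn _)) => E []; rewrite take_size => *; exists E.
elim=> [_|n IH n_lt].
  by exists [::]; split=> //; rewrite /frege_size /= !big_nil.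
have [E [E_uniq E_fresh E_size E_sub E_lines]] := IH (ltnW n_lt).
rewrite (take_nth Ftt n_lt); set a := nth Ftt p n.
have size_rcons_a : frege_size (rcons (take n p) a) = frege_size (take n p) + fform_size a.
  by rewrite /frege_size big_rcons.
have skip : frege_axiom a \/ modus_ponens (take n p) a ->
    exists E : seq (nat * fform),
    [/\ uniq [seq e.1 | e <- E],
        forall j, j < size E -> forall b,
          b \in concl :: [seq e.2 | e <- take j.+1 E] ->
          (nth (0, Ftt) E j).1 \notin fform_vars b,
        frege_size [seq extension_axiom e | e <- E] <= frege_size (rcons (take n p) a),
        {subset [seq extension_axiom e | e <- E] <= rcons (take n p) a}
      & forall i, i < n.+1 ->
          [\/ frege_axiom (nth Ftt p i), modus_ponens (take i p) (nth Ftt p i)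
            | exists2 e, e \in E & nth Ftt p i = extension_axiom e]].
  move=> ha; exists E; split=> //.
  - by rewrite size_rcons_a (leq_trans E_size) ?leq_addr.
  - by move=> b /E_sub bE; rewrite mem_rcons inE bE orbT.
  - move=> i; rewrite ltnS leq_eqVlt => /predU1P[->|/E_lines //].
    by case: ha; [constructor 1 | constructor 2].
case: (hp n n_lt) => [ha|ha|]; [by apply: skip; left | by apply: skip; right |].
case=> A [b [def_a A_new A_b A_concl]]; rewrite -/a in def_a.
have A_old e : e \in E -> A != e.1 /\ A \notin fform_vars e.2.
  move=> eE; have /A_new : extension_axiom e \in take n p by apply/E_sub/map_f.
  by rewrite /= !inE !mem_cat !negb_or => /andP[-> /andP[]].
exists (rcons E (A, b)); split.
- rewrite map_rcons rcons_uniq E_uniq andbT.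
  by apply/mapP=> -[e /A_old[/eqP]].
(* For the last index the whole list has to avoid [A]; for smaller ones the relevant prefix is
   unchanged. *)
- move=> j; rewrite size_rcons ltnS leq_eqVlt => /predU1P[->|jE] c.
    rewrite take_oversize ?size_rcons // nth_rcons ltnn eqxx inE.
    case/predU1P=> [->//|/mapP[e]]; rewrite mem_rcons inE.
    by case/predU1P=> [->|/A_old[_ h]] ->.
  by rewrite -cats1 takel_cat // nth_cat jE; apply: E_fresh.
- rewrite size_rcons_a /frege_size map_rcons big_rcons /=.
  by rewrite leq_add // def_a.
- rewrite map_rcons def_a => c; rewrite !mem_rcons !inE.
  by case/predU1P=> [->|/E_sub->]; rewrite ?eqxx ?orbT.
- move=> i; rewrite ltnS leq_eqVlt => /predU1P[->|/E_lines].
    by constructor 3; exists (A, b) => //; rewrite mem_rcons mem_head.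
  case; [by constructor 1 | by constructor 2 | case=> e eE def_i].
  by constructor 3; exists e => //; rewrite mem_rcons inE eE orbT.
Qed.

Lemma fform_size_le_frege_size a p : a \in p -> fform_size a <= frege_size p.
Proof. by move=> ap; rewrite /frege_size (big_rem a ap) leq_addr. Qed.

(** * Line-by-line simulation *)

(** Each line costs a constant number of rule steps, including the cocontraction that keeps a copy
    of the current conjunction; the final successor is the coweakening that isolates the last
    line. *)
Lemma derives_xFrege :
  exists k w, forall p E,
    p <> [::] ->
    frege_size [seq extension_axiom e | e <- E] <= frege_size p ->
    (forall i, i < size p ->
       [\/ frege_axiom (nth Ftt p i), modus_ponens (take i p) (nth Ftt p i)
         | exists2 e, e \in E & nth Ftt p i = extension_axiom e]) ->
    derives (k * size p).+1 (w * frege_size p)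
      (ext_premiss [seq translate_extension e | e <- E]) (translate (last Ftt p)).
Proof.
(* S stays below 3 n: n + 1 for the premiss and n for the lines. *)
have [k1 [w1 axiom_line]] := derives_frege_axiom.
have [k2 [w2 cut_line]] := derives_cut.
(* An axiom takes 1 + [k1] steps: drop the conjunction, then derive. Modus ponens takes 3 + [k2]:
   one cocontraction, two extractions, then the cut. Extraction has width 4n, doubled to 8n by the
   copy; the cut involves two formulae of size at most n, hence the factor 2 on [w2]. *)
pose k := 3 + k1 + k2; pose w := 8 + w1 + w2 * 2.
exists k.+1, (w * 2) => p E p_neq0 E_size lines.
set n := frege_size p; set P := ext_premiss _.
have p_gt0 : 0 < size p by case: (p) p_neq0.
have n_gt0 : 0 < n.
  apply: leq_trans (fform_size_le_frege_size (mem_nth Ftt p_gt0)).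
  exact: fform_size_gt0.
have P_size : form_size P <= n.+1.
  exact: leq_trans (form_size_ext_premiss E) _.
(* Any conjunction containing the extension axioms and the earlier lines yields the next line within
   the constant bounds. *)
have line i S :
    i < size p -> form_size S <= 3 * n ->
    {in E, forall e, conjunct (translate (extension_axiom e)) S} ->
    {in take i p, forall b, conjunct (translate b) S} ->
    derives k (w * n) S (translate (nth Ftt p i)).
  move=> i_lt S_size SE Sp.
  have conj b : conjunct b S -> derives 1 (4 * n) S b.
    by move/conjunct_derives; apply: derives_leq => //; lia.
  have line_size b : b \in p -> form_size (translate b) <= n.
    by rewrite form_size_translate; apply: fform_size_le_frege_size.
  have pi : nth Ftt p i \in p by apply: mem_nth.
  case: (lines i i_lt) => [ax|[b [bp bap]]|[e eE ->]].
  - apply: (@derives_leq (1 + k1) (3 * n + w1 * n)); first by rewrite /k; lia.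
      by rewrite /w; nia.
    apply: (@derives_trans _ _ _ _ Tt).
      by apply: derives_rule_step (coweakening_step S) _ _ => /=; lia.
    apply: derives_leq (axiom_line _ ax) => //.
    have := line_size _ pi; rewrite form_size_translate; nia.
  - apply: (@derives_leq (3 + k2) (8 * n + w2 * 2 * n)); first by rewrite /k; lia.
      by rewrite /w; nia.
    have mp := derives_and_intro (conj _ (Sp b bp)) (conj _ (Sp _ bap)).
    apply: derives_trans (derives_leq (leqnn _) _ mp) _; first by lia.
    apply: derives_leq (cut_line _ _) => //.
    apply: leq_trans (leq_addl _ _).
    by rewrite -mulnA mul2n -addnn leq_mul ?leq_add ?line_size ?(mem_take bp).
  - by apply: derives_leq (conj _ (SE e eE)); rewrite /k /w; nia.
(* Invariant after [i] lines: the conjunction [S] is reached from the premiss [P], grows only by the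
   sizes of these lines, and contains them along with all extension axioms. *)
have state : forall i, i <= size p -> exists S,
    [/\ derives (k.+1 * i) (w * 2 * n) P S,
        form_size S <= form_size P + frege_size (take i p),
        {in E, forall e, conjunct (translate (extension_axiom e)) S}
      & {in take i p, forall b, conjunct (translate b) S}].
  elim=> [_|i IH i_lt].
    exists P; split; last by rewrite take0.
    - by apply: derives_equiv (fe_refl P) _ _; rewrite /w; nia.
    - by rewrite leq_addr.
    - by move=> e; apply: conjunct_ext_premiss.
  have [S [PS S_size SE Sp]] := IH (ltnW i_lt).
  have take_le j : frege_size (take j p) <= n.
    rewrite /n -{2}(cat_take_drop j p) /frege_size big_cat /=; exact: leq_addr.
  have S_le : form_size S <= 3 * n by have := take_le i; lia.
  have S_line := line i S i_lt S_le SE Sp.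
  exists (And S (translate (nth Ftt p i))); split.
  - rewrite mulnSr; apply: derives_trans PS _.
    (* One copy of [S] is left untouched, so the line costs [k] rule steps plus the
       cocontraction. *)
    have S_refl : derives 0 (w * n) S S.
      by apply: derives_equiv (fe_refl S) _ _; rewrite /w; nia.
    by apply: derives_leq (derives_and_intro S_refl S_line) => //; nia.
  - rewrite (take_nth Ftt i_lt) /frege_size big_rcons /= form_size_translate.
    by move: S_size; rewrite /frege_size /=; lia.
  - by move=> e eE; apply/conjunct_andl/SE.
  - move=> b; rewrite (take_nth Ftt i_lt) mem_rcons inE => /predU1P[->|bp].
      exact/conjunct_andr/conjunct_refl.
    exact/conjunct_andl/Sp.
have [S [PS S_size _ Sp]] := state _ (leqnn _).
rewrite take_size in S_size Sp.
rewrite -addn1; apply: derives_trans PS _.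
have /Sp/conjunct_derives : last Ftt p \in p.
  by rewrite -nth_last mem_nth // prednK.
by apply: derives_leq => //; rewrite /w; move: S_size; rewrite -/n; nia.
Qed.

Theorem theorem5p4 :
  exists c d : nat,
    forall (p : seq fform) (alpha : fform),
      xFrege_proof p alpha ->
      exists (E : seq (literal * form)) (s : seq form),
        [/\ xSKSg_proof E s (translate alpha),
            derivation_length (ext_premiss E) s <= c * frege_length p
          & derivation_size (ext_premiss E) s <= d * frege_size p ^ 2].
Proof.
have [k [w sim]] := derives_xFrege.
(* With kl+1 rule steps of width wn, there are at most 2kl+3 steps and size (2kl+4)wn; l is at least
   1 and at most n. *)
exists (k.*2 + 3), ((k.*2 + 4) * w) => p alpha p_proof.
have [E [E_uniq E_fresh E_size lines]] := frege_extensions p_proof.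
have [p_neq0 p_last _] := p_proof.
have [s [s_deriv s_last s_length s_size]] :=
  derives_derivation (sim p E p_neq0 E_size lines).
have p_gt0 : 0 < size p by case: (p) p_neq0.
exists [seq translate_extension e | e <- E], s; split.
- split=> //; last by rewrite s_last p_last.
    by rewrite -map_comp (map_comp (fun n => [:: (n, false); neg (n, false)]) fst) uniq_literals.
  rewrite size_map => i iE b; rewrite -map_take -map_comp => bE.
  rewrite (nth_map (0, Ftt)) //=.
  have [c cE ->] : exists2 c, c \in alpha :: [seq e.2 | e <- take i.+1 E] & b = translate c.
    move: bE; rewrite inE => /predU1P[->|/mapP[e eE ->]].
      by exists alpha; rewrite ?mem_head.
    by exists e.2; rewrite // inE map_f ?orbT.
  (* Both literals of a variable share its index, so one freshness fact excludes both. *)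
  by split; apply: contra (E_fresh i iE c cE) => /form_vars_translate.
- by apply: leq_trans s_length _; rewrite /frege_length; nia.
(* Every line has size at least 1; this turns the bound O(ln) into O(n^2). *)
- have p_le : size p <= frege_size p.
    rewrite /frege_size -sum1_size; apply: leq_sum => a _; exact: fform_size_gt0.
  apply: leq_trans s_size _; rewrite mulnA -mulnn mulnA leq_mul2r.
  apply/orP; right; rewrite mulnAC leq_mul2r; apply/orP; right; nia.
Qed.
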